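(* For a given linear consensus network $\mathcal N(L_{\mathcal G})\in\mathfrak N(x_0)$, we have $$\|G(s)\|_{\mathcal H_p}^p=\frac{-1}{\beta\left(\frac p2,-\frac12\right)}\,\zeta_{\mathcal G}(p-1)$$ for every $1\le p\le\infty$, where $\zeta_{\mathcal G}$ is the spectral zeta function of the underlying graph $\mathcal G$ and $\beta$ is the beta function.
   Context: All graphs are finite, simple, undirected, connected, on $n$ nodes, with positive edge weights: $\mathcal G=(V(\mathcal G),E(\mathcal G),w)$, $w:E(\mathcal G)\to(0,\infty)$. The Laplacian is $L_{\mathcal G}=\Delta-A$, where $A=[a_{ij}]$ has $a_{ij}=w(e)$ if $e=\{i,j\}\in E(\mathcal G)$ and $a_{ij}=0$ otherwise, and $\Delta=\mathrm{diag}(d_1,\dots,d_n)$ with $d_i=\sum_{e=\{i,j\}\in E(\mathcal G)}w(e)$. Its eigenvalues are $0=\lambda_1\le\lambda_2\le\dots\le\lambda_n$. Let $M_n=I_n-\frac1n\mathbf 1_n\mathbf 1_n^T$, where $\mathbf 1_n$ is the all-ones vector. The linear consensus network $\mathcal N(L_{\mathcal G})$ is the system $\dot x(t)=-L_{\mathcal G}x(t)+\xi(t)$, $y(t)=M_nx(t)$, with exogenous disturbance input $\xi$, output $y$ and fixed initial condition $x_0$; $\mathfrak N(x_0)$ is the set of all such networks. Its transfer function from $\xi$ to $y$ is $G(s)=M_n(sI_n+L_{\mathcal G})^{-1}$, regarded as a rational matrix function (the singularity at $s=0$ is removable). Its input-output $\mathcal H_p$-norm, for $1\le p\le\infty$,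 is $$\|G(s)\|_{\mathcal H_p}=\left(\frac1{2\pi}\int_{-\infty}^{\infty}\|G(j\omega)\|_{p^\ast}^p\,d\omega\right)^{1/p},$$ where $\|A\|_{p^\ast}=\left(\sum_{i=1}^n\sigma_i^p\right)^{1/p}$ is the Schatten $p$-norm ($\sigma_i$ the singular values of $A$; for $p=\infty$ it is the spectral norm, and the $\mathcal H_\infty$-norm is $\sup_{\omega\in\mathbb R}\|G(j\omega)\|_{\infty^\ast}$). The spectral zeta function is $\zeta_{\mathcal G}(q)=\sum_{\lambda_i\ne0}\lambda_i^{-q}$ for real $q$. The beta function is $\beta(x,y)=\int_0^1t^{x-1}(1-t)^{y-1}\,dt=\Gamma(x)\Gamma(y)/\Gamma(x+y)$ for $\mathrm{Re}\,x,\mathrm{Re}\,y>0$, where $\Gamma$ is the gamma function; at $y=-\frac12$ it is understood through the expression $\Gamma(x)\Gamma(y)/\Gamma(x+y)$ with the meromorphically continued gamma function.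
   Formalization: At p=∞ the equation has no literal meaning, so it is read as: the p-th root of the right-hand side tends to the H_∞-norm as p→∞. At p=1, where β(1/2,-1/2)=0, the factor -1/β is read as +∞ (with +∞·0=0 when n=1). *)

(* Defs.v *)
From HB Require Import structures.
From mathcomp Require Import all_boot all_order all_algebra.
From mathcomp Require Import complex.
From mathcomp Require Import all_classical all_reals all_analysis.

Set Implicit Arguments.
Unset Strict Implicit.
Unset Printing Implicit Defensive.

Import Order.TTheory GRing.Theory Num.Theory.
Import numFieldNormedType.Exports.

Local Open Scope classical_set_scope.
Local Open Scope complex_scope.
Local Open Scope ring_scope.

(* Edges are unordered pairs, i.e. two-element subsets of 'I_n; only the values
   of [weight] on [edges] are ever used. *)
Record wgraph (R : realType) (n : nat) := WGraph {
  edges : {set {set 'I_n}};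
  weight : {set 'I_n} -> R;
  edges_card2 : forall e, e \in edges -> #|e| = 2%N;
  weight_gt0 : forall e, e \in edges -> 0 < weight e;
  wgraph_connected :
    forall i j : 'I_n, connect [rel u v | [set u; v]%SET \in edges] i j
}.

Section Laplacian.
Variables (R : realType) (n : nat).
Implicit Type G : wgraph R n.

Definition adjacency G : 'M[R]_n :=
  \matrix_(i, j) (if [set i; j]%SET \in edges G then weight G [set i; j]%SET
                  else 0).

Definition degree G (i : 'I_n) : R :=
  \sum_(e in edges G | i \in e) weight G e.

Definition laplacian G : 'M[R]_n :=
  diag_mx (\row_i degree G i) - adjacency G.

End Laplacian.

Section Spectra.
Variables (R : realType) (n : nat).

(* All complex eigenvalues, with multiplicity. *)
Definition eigenvalues (A : 'M[R[i]]_n) : seq R[i] :=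
  sval (closed_field_poly_normal (char_poly A)).

(* The Laplacian is symmetric and A^* A is Hermitian positive semidefinite, so
   that in the next two definitions the eigenvalues are real and [Re] only
   changes their type. *)
Definition laplacian_eigenvalues (G : wgraph R n) : seq R :=
  [seq complex.Re z | z <- eigenvalues (map_mx (real_complex R) (laplacian G))].

Definition singular_values (A : 'M[R[i]]_n) : seq R :=
  [seq Num.sqrt (complex.Re z)
     | z <- eigenvalues (map_mx (@conjc R) A^T *m A)].

(* Meant for 1 <= p; the exponent -oo gets the same junk value as +oo. *)
Definition schatten_norm (p : \bar R) (A : 'M[R[i]]_n) : R :=
  if p is r%:E then (\sum_(s <- singular_values A) s `^ r) `^ r^-1
  else \big[Num.max/0]_(s <- singular_values A) s.

Definition zeta (G : wgraph R n) (q : R) : R :=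
  \sum_(l <- laplacian_eigenvalues G | l != 0) l `^ (- q).

End Spectra.

(* The network  x'(t) = - L x(t) + xi(t),  y(t) = M x(t),  x(0) = x_0,  where L
   is the Laplacian of the graph and M = I - (1/n) 1 1^T. *)
Record consensus_network (R : realType) (n : nat) := ConsensusNetwork {
  network_graph : wgraph R n;
  initial_state : 'cV[R]_n
}.

Section Transfer.
Variables (R : realType) (n : nat).

Definition centering : 'M[R]_n := 1%:M - const_mx (n%:R^-1).

Definition transfer_formula (N : consensus_network R n) (s : R[i])
    : 'M[R[i]]_n :=
  map_mx (real_complex R) centering *m
  invmx (s%:M + map_mx (real_complex R) (laplacian (network_graph N))).

(* [invmx] is junk on singular matrices: where s I + L is singular the rational
   matrix function is evaluated by continuity, which is meaningful at the
   removable singularity s = 0.  The type R[i]^o carries the topology of the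
   modulus on R[i]. *)
Definition transfer_function (N : consensus_network R n) (s : R[i])
    : 'M[R[i]]_n :=
  if s%:M + map_mx (real_complex R) (laplacian (network_graph N)) \in unitmx
  then transfer_formula N s
  else \matrix_(i, j)
         lim ((transfer_formula N z i j : R[i]^o) @[z --> (s : R[i]^o)^']).

(* H_p norm of a matrix function; +oo is a possible value. *)
Definition hp_norm (p : \bar R) (F : R[i] -> 'M[R[i]]_n) : \bar R :=
  if p is r%:E then
    (((2 * pi)^-1)%:E *
       \int[lebesgue_measure]_w ((schatten_norm p (F (0 +i* w))) `^ r)%:E)%E
      `^ r^-1
  else ereal_sup (range (fun w : R => (schatten_norm p (F (0 +i* w)))%:E)).

End Transfer.

Section GammaBeta.
Variable R : realType.

Definition euler_gamma (x : R) : R :=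
  (\int[lebesgue_measure]_(t in `]0%R, +oo[) (t `^ (x - 1) * expR (- t)))%R.

(* Meromorphic continuation to the real line, through
   Gamma(x) = Gamma(x + k) / (x (x + 1) ... (x + k - 1)) with k such that
   x + k > 0.  At a pole the product vanishes and the value is 0. *)
Definition gamma (x : R) : R :=
  if 0 < x then euler_gamma x
  else let k := (absz (Num.floor x)).+1 in
       euler_gamma (x + k%:R) / \prod_(0 <= i < k) (x + i%:R).

(* When x + y is a pole of Gamma and x, y are not, the division by
   [gamma (x + y) = 0] gives 0, the value of the continued function. *)
Definition beta (x y : R) : R := gamma x * gamma y / gamma (x + y).

End GammaBeta.

(* The right-hand side  -1 / beta(p/2, -1/2) * zeta(p - 1)  for 1 <= p < +oo.
   For p > 1 the value beta(p/2, -1/2) is negative; for p = 1 it is 0, and -1/0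
   is read as the limit +oo from p > 1, i.e. (- beta)^-1 with 0^-1 = +oo. *)
Definition neg_inv_beta_zeta (R : realType) (n : nat) (G : wgraph R n) (p : R)
    : \bar R :=
  ((- beta (p / 2) (- 2^-1))%:E^-1 * (zeta G (p - 1))%:E)%E.

(* Main.v *)
Require Import Defs.
From HB Require Import structures.
From mathcomp Require Import all_boot all_order all_algebra.
From mathcomp Require Import complex spectral sesquilinear.
From mathcomp Require Import all_classical all_reals all_analysis.
From mathcomp Require Import measurable_realfun ring lra.

(* In an orthonormal eigenbasis of the Laplacian, M (s + L)^-1 is diagonal with
   entries 1 / (s + l) for the eigenvalues l <> 0; connectedness makes the kernel
   of L the constant vectors, which M projects out. Hence the p-th power of the
   Schatten norm at s = i w is the sum of (l^2 + w^2)^(-p/2) over l <> 0, at w = 0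
   too, by continuity. Writing Gamma(p/2) (l^2 + w^2)^(-p/2) as the integral of
   u^(p/2-1) exp(-u (l^2 + w^2)) du and integrating in w by Tonelli's theorem
   leaves a Gaussian integral, so that the integral over w equals
   sqrt(pi) l^(1-p) Gamma((p-1)/2) / Gamma(p/2); with Gamma(-1/2) = -2 sqrt(pi)
   this is the beta factor. As p tends to +oo, the p-th root of the sum of these
   integrals is squeezed between quantities tending to 1 / (m + e), for every
   e > 0, and to 1 / m, where m is the least non-zero eigenvalue. *)

Set Implicit Arguments.
Unset Strict Implicit.
Unset Printing Implicit Defensive.

Import Order.TTheory GRing.Theory Num.Theory.
Import numFieldNormedType.Exports.
Local Open Scope classical_set_scope.
Local Open Scope ring_scope.

(** * The Gamma integral and the integrals of (l^2 + w^2)^(-p/2) *)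

Section GammaIntegral.
Variable R : realType.
Local Notation mu := (@lebesgue_measure R).

(** * Scaling of Lebesgue measure and of the Gamma and Gaussian integrals *)

Lemma lebesgue_measure_unique_scaled
    (m : {measure set (measurableTypeR R) -> \bar R}) (c : {nonneg R}) :
  (forall X, ocitv X -> mu X = c%:num%:E * m X)%E ->
  forall A, measurable A -> (mu A = c%:num%:E * m A)%E.
Proof. exact: (@lebesgue_measure_unique R (mscale c m)). Qed.

(** Both sides are measures agreeing on the half-open intervals, since the preimage of ]a, b] is ]a
    / c, b / c]; this determines Lebesgue measure. *)
Lemma lebesgue_measure_scale (c : R) (c0 : 0 < c) (A : set R) : measurable A ->
  (mu A = c%:E * pushforward mu ( *%R c : _ -> measurableTypeR R) A)%E.
Proof.
have mc : measurable_fun setT ( *%R c : measurableTypeR R -> measurableTypeR R).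
  by apply: measurable_funM; [exact: measurable_cst|exact: measurable_id].
move=> mA; apply: (lebesgue_measure_unique_scaled (c := NngNum (ltW c0))) => //=.
move=> _ [[a b]] /= _ <-.
rewrite /pushforward.
have -> : *%R c @^-1` `]a, b] = `](a / c), (b / c)]%classic.
  by apply/seteqP; split => x /=; rewrite !in_itv/= ltr_pdivrMr// ler_pdivlMr// mulrC.
rewrite !lebesgue_measure_itv/= !lte_fin ltr_pM2r ?invr_gt0//.
case: ifP => _; last by rewrite mule0.
by rewrite -!EFinD -EFinM -mulrBl mulrCA mulfV ?mulr1// gt_eqF.
Qed.

(** The substitution is read off the identity of measures, so that [f] may be any non-negative
    measurable function and the integral may be +oo. *)
Lemma ge0_integral_scale (c : R) (c0 : 0 < c) (D : set R) (f : R -> \bar R) :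
  measurable D -> measurable_fun D f -> (forall x, D x -> 0 <= f x)%E ->
  (\int[mu]_(x in D) f x = c%:E * \int[mu]_(x in *%R c @^-1` D) f (c * x)%R)%E.
Proof.
move=> mD mf f0.
have mc : measurable_fun setT ( *%R c : measurableTypeR R -> measurableTypeR R).
  by apply: measurable_funM; [exact: measurable_cst|exact: measurable_id].
rewrite -[X in (_ = _ * X)%E](ge0_integral_pushforward mc)//; last first.
  by move=> x; rewrite inE; exact: f0.
rewrite -[RHS](ge0_integral_mscale _ _ (NngNum (ltW c0)))//.
apply: eq_measure_integral => A mA _.
exact: lebesgue_measure_scale.
Qed.

(* The Gamma integral as an extended real: Tonelli then applies without
   integrability conditions, and the value is +oo at the pole 0. *)
Definition egamma (x : R) : \bar R :=
  (\int[mu]_(t in `]0%R, +oo[) (t `^ (x - 1) * expR (- t))%:E)%E.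

Lemma measurable_gamma_fun (D : set R) a c :
  measurable_fun D (fun t : R => (t `^ a * expR (- (t * c)))%:E).
Proof.
apply/measurable_EFinP/measurable_funTS/measurable_funM.
  exact: measurable_powR.
apply: measurableT_comp => //; apply: measurableT_comp => //.
by apply: measurable_funM; [exact: measurable_id|exact: measurable_cst].
Qed.

Lemma egamma_scale (c a : R) : 0 < c ->
  (\int[mu]_(t in `]0%R, +oo[) (t `^ (a - 1) * expR (- (t * c)))%:E
   = (c `^ (- a))%:E * egamma a)%E.
Proof.
move=> c0; rewrite /egamma.
rewrite (ge0_integral_scale (f := fun t => (t `^ (a - 1) * expR (- t))%:E) c0)//; last 2 first.
- by apply: eq_measurable_fun (measurable_gamma_fun (a - 1) 1) => t _; rewrite mulr1.
- by move=> x _; rewrite lee_fin mulr_ge0 ?powR_ge0 ?expR_ge0.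
have -> : *%R c @^-1` `]0%R, +oo[ = `]0%R, +oo[%classic :> set R.
  by apply/seteqP; split => x /=; rewrite !in_itv/= !andbT pmulr_rgt0.
(* The substitution brings c from dt and c^(a-1) from the power of t; together they cancel
   c^(-a). *)
transitivity ((c `^ (-a))%:E * (c%:E * \int[mu]_(x in `]0%R, +oo[) ((c `^ (a - 1))%:E *
   (x `^ (a - 1) * expR (- (x * c)))%:E)))%E; last first.
  congr (_ * (_ * _))%E; apply: eq_integral => x.
  rewrite inE/= in_itv/= andbT => x0.
  by rewrite -EFinM powRM ?ltW// [x * c]mulrC mulrA.
rewrite ge0_integralZl//; last 3 first.
- exact: measurable_gamma_fun.
- by move=> x _; rewrite lee_fin mulr_ge0 ?powR_ge0 ?expR_ge0.
- by rewrite lee_fin powR_ge0.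
rewrite !muleA -!EFinM.
rewrite [X in X%:E](_ : _ = 1) ?mul1e//.
rewrite -{2}(powRr1 (ltW c0)) -!powRD; last 2 first.
- by rewrite (gt_eqF c0) implybT.
- by rewrite (gt_eqF c0) implybT.
by rewrite (_ : _ + _ = 0) ?powRr0//; lra.
Qed.

Lemma integral_gauss_scale (u : R) : 0 < u ->
  (\int[mu]_w (expR (- (u * w ^+ 2)))%:E = (Num.sqrt pi * u `^ (- 2^-1))%:E)%E.
Proof.
move=> u0; have su0 : 0 < Num.sqrt u by rewrite sqrtr_gt0.
rewrite powRN powR12_sqrt ?ltW// EFinM -integralT_gauss.
rewrite (ge0_integral_scale (f := fun x => (gauss_fun x)%:E) su0)//; last 2 first.
- by apply/measurable_EFinP; exact: measurable_gauss_fun.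
- by move=> x _; rewrite lee_fin gauss_fun_ge0.
rewrite muleAC -EFinM mulfV ?gt_eqF// mul1e preimage_setT.
by apply: eq_integral => x _; rewrite /gauss_fun exprMn sqr_sqrtr// ltW.
Qed.

(** With c = x^2 this turns the Gaussian into a tail of the exponential, which is how [egamma_3half]
    uses it. *)
Lemma integral_expRN (c : R) :
  (\int[mu]_(t in `[c, +oo[) (expR (- t))%:E = (expR (- c))%:E)%E.
Proof.
rewrite (@ge0_continuous_FTC2y _ _ (fun t => - expR (- t)) _ 0) //.
- by rewrite sub0e -EFinN opprK.
- apply: continuous_subspaceT => x; apply: continuous_comp; first exact: continuousN.
  exact: continuous_expR.
- rewrite -oppr0; apply: cvgN; exact: cvgr_expR.
- apply: cvg_at_right_filter; apply: cvgN; apply: continuous_comp; first exact: continuousN.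
  exact: continuous_expR.
- by move=> x _; rewrite derive1E derive_val mulrN1 opprK. 
Qed.

Lemma egamma_ge0 a : (0 <= egamma a)%E.
Proof. by apply: integral_ge0 => t _; rewrite lee_fin mulr_ge0 ?powR_ge0 ?expR_ge0. Qed.

Lemma sqrD_gt0 (l w : R) : 0 < l -> 0 < l ^+ 2 + w ^+ 2.
Proof. by move=> l0; rewrite ltr_wpDr ?sqr_ge0// exprn_gt0. Qed.

Lemma measurable_sqrD_powR (l a : R) (D : set R) :
  measurable_fun D (fun w : R => ((l ^+ 2 + w ^+ 2) `^ a)%:E).
Proof.
apply/measurable_EFinP/measurable_funTS.
apply: (measurableT_comp (measurable_powR a)).
apply: measurable_funD; first exact: measurable_cst.
by apply: measurable_funX; exact: measurable_id.
Qed.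

(* Tonelli's theorem for u^(a-1) exp(-u (l^2 + w^2)): integrating first in u
   gives the left-hand side, first in w the right-hand side. *)
Lemma egamma_integral_powR (l a : R) : 0 < l ->
  (egamma a * \int[mu]_w ((l ^+ 2 + w ^+ 2) `^ (- a))%:E
   = (Num.sqrt pi * l `^ (1 - 2 * a))%:E * egamma (a - 2^-1))%E.
Proof.
move=> l0.
pose D : set R := `]0%R, +oo[%classic.
have mD : measurable (D : set (measurableTypeR R)) by exact: measurable_itv.
(* Here [z.1] is u and [z.2] is w; the indicator extends the integrand by 0 to the whole plane. *)
pose h (z : measurableTypeR R * measurableTypeR R) : \bar R :=
  (\1_D z.1 * (z.1 `^ (a - 1) * expR (- (z.1 * (l ^+ 2 + z.2 ^+ 2)))))%:E.
have h0 z : (0 <= h z)%E.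
  by rewrite lee_fin mulr_ge0 ?mulr_ge0 ?powR_ge0 ?expR_ge0.
have mh : measurable_fun setT h.
  apply/measurable_EFinP/measurable_funM.
    by apply: (measurableT_comp (f := (\1_D : measurableTypeR R -> R))) => //;
      exact: measurable_indic.
  apply: measurable_funM.
    by apply: (measurableT_comp (measurable_powR (a - 1))).
  apply: measurableT_comp => //; apply: measurableT_comp => //.
  apply: measurable_funM => //; apply: measurable_funD => //.
  by apply: measurable_funX.
have := fubini_tonelli (m1 := mu) (m2 := mu) h mh h0.
have -> : (\int[mu]_x \int[mu]_y h (x, y) =
  (Num.sqrt pi * l `^ (1 - 2 * a))%:E * egamma (a - 2^-1))%E.
  transitivity (\int[mu]_(x in D) ((Num.sqrt pi)%:E *
      (x `^ ((a - 2^-1) - 1) * expR (- (x * l ^+ 2)))%:E))%E.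
    rewrite [RHS]integral_mkcond; apply: eq_integral => x _ /=; rewrite patchE.
    case: ifPn => xD; last first.
      apply: integral0_eq => y _.
      by rewrite /h/= indicE (negbTE xD) mul0r.
    have x0 : 0 < x by move: xD; rewrite inE /D/= in_itv/= andbT.
    transitivity (\int[mu]_y ((x `^ (a - 1) * expR (- (x * l ^+ 2)))%:E *
                              (expR (- (x * y ^+ 2)))%:E))%E.
      apply: eq_integral => y _; rewrite /h/= indicE xD mul1r -EFinM.
      by rewrite mulrDr opprD expRD mulrA.
    rewrite ge0_integralZl//; last 2 first.
    - apply/measurable_EFinP; apply: measurableT_comp => //.
      apply: measurableT_comp => //.
      by apply: measurable_funM => //; exact: measurable_funX.
    - by rewrite lee_fin mulr_ge0 ?powR_ge0 ?expR_ge0.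
    rewrite integral_gauss_scale// -!EFinM; congr EFin.
    (* The Gaussian integral in w contributes u^(-1/2), which shifts the argument of Gamma from a to
       a - 1/2. *)
    rewrite (_ : a - 2^-1 - 1 = (a - 1) + - 2^-1); last by ring.
    rewrite [in RHS]powRD; last by rewrite (gt_eqF x0) implybT.
    ring.
  rewrite ge0_integralZl//; last 2 first.
  - exact: measurable_gamma_fun.
  - by move=> x _; rewrite lee_fin mulr_ge0 ?powR_ge0 ?expR_ge0.
  rewrite egamma_scale ?exprn_gt0// muleA -EFinM.
  congr ((_ * _)%:E * _)%E.
  by rewrite -powR_mulrn ?ltW// -powRrM; congr (_ `^ _); field.
have -> : (\int[mu]_y \int[mu]_x h (x, y) =
   egamma a * \int[mu]_w ((l ^+ 2 + w ^+ 2) `^ (- a))%:E)%E.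
  rewrite -ge0_integralZl//; last 3 first.
  - exact: measurable_sqrD_powR.
  - by move=> x _; rewrite lee_fin powR_ge0.
  - exact: egamma_ge0.
  apply: eq_integral => w _; rewrite muleC -egamma_scale ?sqrD_gt0//.
  rewrite [RHS]integral_mkcond; apply: eq_integral => x _ /=; rewrite patchE /h/= indicE.
  by case: ifPn => xD; rewrite ?mul1r ?mul0r.
by [].
Qed.

Lemma egamma_gt0 (a : R) : (0 < egamma a)%E.
Proof.
(* A lower bound of the integrand on [1, 2]: there 0 <= ln t <= 2 and t <= 2, so the exponent (a -
   1) ln t - t is at least -2 (|a - 1| + 1). *)
pose k := expR (- (2 * (`|a - 1| + 1))).
apply: (@lt_le_trans _ _ (k%:E)); first by rewrite lte_fin expR_gt0.
apply: (@le_trans _ _ (\int[mu]_(t in `[1%R, 2%R]) (t `^ (a - 1) * expR (- t))%:E)%E).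
  apply: (@le_trans _ _ (\int[mu]_(t in `[1%R, 2%R]) (cst k%:E t))%E).
    rewrite integral_cst//= lebesgue_measure_itv/= lte_fin ltr1n -EFinD.
    by rewrite (_ : 2 - 1 = 1) ?mule1//; ring.
  apply: ge0_le_integral => //.
  - by move=> x _; rewrite lee_fin expR_ge0.
  - by apply: eq_measurable_fun (measurable_gamma_fun (a - 1) 1) => t _; rewrite mulr1.
  - move=> x /=; rewrite in_itv/= => /andP[x1 x2].
    have x0 : 0 < x by lra.
    rewrite lee_fin /powR gt_eqF// -expRD ler_expR mulrDr mulr1 opprD.
    rewrite lerD ?lerN2// lerNl -mulNr.
    have l0 : 0 <= ln x by rewrite ln_ge0.
    have l2 : ln x <= 2.
      by rewrite (le_trans _ x2)// ltW// ln_sublinear.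
    apply: (@le_trans _ _ (`|a - 1| * ln x)); last by rewrite mulrC ler_wpM2r.
    by rewrite ler_wpM2r// ler_normr lexx orbT.
apply: ge0_subset_integral => //.
- by apply: eq_measurable_fun (measurable_gamma_fun (a - 1) 1) => t _; rewrite mulr1.
- by move=> x _; rewrite lee_fin mulr_ge0 ?powR_ge0 ?expR_ge0.
- by move=> x /=; rewrite !in_itv/= andbT => /andP[x1 _]; lra.
Qed.

(** * Finiteness of the Gamma integral *)

Lemma egamma1_lty : (egamma (1 : R) < +oo)%E.
Proof.
apply: (@le_lt_trans _ _ (\int[mu]_(t in `[0%R, +oo[) (expR (- t))%:E)%E); last first.
  by rewrite integral_expRN ltry.
rewrite /egamma subrr; under eq_integral do rewrite powRr0 mul1r.
apply: ge0_subset_integral => //.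
- apply: eq_measurable_fun (measurable_gamma_fun 0 1) => t _.
  by rewrite mulr1 powRr0 mul1r.
- by move=> x /=; rewrite !in_itv/= !andbT => /ltW.
Qed.

(* If Gamma(0) were finite, exp(-t) >= (1 + t) exp(-2t) and the scale invariance
   of dt/t would give Gamma(0) >= Gamma(0) + Gamma(1) / 2. *)
Lemma egamma0 : egamma (0 : R) = +oo%E.
Proof.
have [//|] := eqVneq (egamma (0 : R)) +oo%E; rewrite -ltey => g0y.
have g0f : egamma (0 : R) \is a fin_num by rewrite ge0_fin_numE ?egamma_ge0.
suff : (egamma (0 : R) + ((2 : R) `^ (- 1))%:E * egamma (1 : R) <= egamma (0 : R))%E.
  rewrite -[leRHS]adde0 leeD2lE// leNgt mule_gt0// ?egamma_gt0// lte_fin powR_gt0//.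
have : (egamma (0 : R) = (2 `^ (- 0))%:E * egamma (0 : R))%E.
  by rewrite oppr0 powRr0 mul1e.
move=> {1}->; rewrite -!egamma_scale// -ge0_integralD//; last 4 first.
- by move=> x _; rewrite lee_fin mulr_ge0 ?powR_ge0 ?expR_ge0.
- exact: measurable_gamma_fun.
- by move=> x _; rewrite lee_fin mulr_ge0 ?powR_ge0 ?expR_ge0.
- exact: measurable_gamma_fun.
apply: ge0_le_integral => //.
- by move=> x _; rewrite -EFinD lee_fin addr_ge0 ?mulr_ge0 ?powR_ge0 ?expR_ge0.
- by apply: emeasurable_funD; exact: measurable_gamma_fun.
- by apply: eq_measurable_fun (measurable_gamma_fun (0 - 1) 1) => t _; rewrite mulr1.
move=> x /=; rewrite in_itv/= andbT => x0.
rewrite -EFinD lee_fin subrr powRr0 mul1r sub0r powR_inv1 ?(ltW x0)//.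
rewrite -[X in _ + X]mul1r -mulrDl.
rewrite (_ : x^-1 + 1 = x^-1 * (1 + x)); last first.
  by rewrite mulrDr mulr1 mulVf// gt_eqF.
rewrite -mulrA ler_wpM2l ?invr_ge0 ?(ltW x0)//.
apply: (@le_trans _ _ (expR x * expR (- (x * 2)))).
  by rewrite ler_wpM2r ?expR_ge0 ?expR_ge1Dx.
by rewrite -expRD ler_expR; lra.
Qed.

(** With b = a - 1, the inequality 1 + y <= exp y at y = t / (2b) gives t^b <= (2b)^b exp(t/2). What
    remains is exp(-t/2), whose integral is a multiple of Gamma(1). *)
Lemma egamma_gt1_lty (a : R) : 1 < a -> (egamma a < +oo)%E.
Proof.
move=> a1; pose b := a - 1; have b0 : 0 < b by rewrite subr_gt0.
apply: (@le_lt_trans _ _ (((2 * b) `^ b)%:E * ((2^-1 `^ (- 1))%:E * egamma 1)))%E; last first.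
  by rewrite muleA -EFinM lte_mul_pinfty ?egamma1_lty// lee_fin mulr_ge0 ?powR_ge0.
rewrite -(egamma_scale (c := 2^-1) 1) ?invr_gt0// -ge0_integralZl//; last 3 first.
- exact: measurable_gamma_fun.
- by move=> x _; rewrite lee_fin mulr_ge0 ?powR_ge0 ?expR_ge0.
- by rewrite lee_fin powR_ge0.
apply: ge0_le_integral => //.
- by move=> x _; rewrite lee_fin mulr_ge0 ?powR_ge0 ?expR_ge0.
- by apply: eq_measurable_fun (measurable_gamma_fun (a - 1) 1) => t _; rewrite mulr1.
- by apply: measurable_funeM; exact: measurable_gamma_fun.
move=> x /=; rewrite in_itv/= andbT => x0.
rewrite -EFinM lee_fin subrr powRr0 mul1r -/b.
apply: (@le_trans _ _ ((2 * b) `^ b * expR (x / 2) * expR (- x))).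
  rewrite ler_wpM2r ?expR_ge0//.
  have -> : expR (x / 2) = expR (x / (2 * b)) `^ b.
    by rewrite -expRM; congr expR; field; rewrite gt_eqF.
  rewrite -powRM ?expR_ge0 ?mulr_ge0 ?(ltW b0)//.
  rewrite ge0_ler_powR ?nnegrE ?(ltW x0) ?mulr_ge0 ?expR_ge0 ?(ltW b0)//.
  apply: (@le_trans _ _ (2 * b * (1 + x / (2 * b)))); last first.
    by rewrite ler_wpM2l ?expR_ge1Dx// mulr_ge0// ltW.
  have b20 : 2 * b != 0 by rewrite gt_eqF// mulr_gt0.
  by rewrite mulrDr mulr1 mulrCA mulfV// mulr1 lerDr mulr_ge0// ltW.
rewrite -mulrA -expRD ler_wpM2l ?powR_ge0// ler_expR; lra.
Qed.

Lemma cvg_powRN_1D (b : R) : 0 < b -> (1 + w) `^ (- b) @[w --> +oo] --> (0 : R).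
Proof.
move=> b0; apply/cvgrPdist_lt => e e0.
near=> w.
have w0 : 0 < w by near: w; exact: nbhs_pinfty_gt.
have w10 : 0 < 1 + w by rewrite addr_gt0.
rewrite sub0r normrN ger0_norm ?powR_ge0//.
(* Writing e as a power with exponent -b reduces the estimate to w > e^(-1/b). *)
have eE : e = (e `^ (- b^-1)) `^ (- b).
  by rewrite -powRrM mulrNN mulVf ?gt_eqF// powRr1// ltW.
rewrite [ltRHS]eE powRN [ltRHS]powRN ltf_pV2 ?posrE ?powR_gt0//.
apply: gt0_ltr_powR; rewrite ?nnegrE ?powR_ge0 ?(ltW w10)//.
apply: (@lt_trans _ _ w); last by rewrite ltrDr.
by near: w; exact: nbhs_pinfty_gt.
Unshelve. all: by end_near. Qed.

Lemma is_derive_1D_powR (c x : R) : 0 <= x ->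
  is_derive x 1 (fun w => (1 + w) `^ c) (c * (1 + x) `^ (c - 1)).
Proof.
move=> x0; have x1 : 0 < 1 + x by rewrite ltr_pwDl.
have d1 : is_derive (1 + x) 1 (@powR R ^~ c) (c * (1 + x) `^ (c - 1)).
  exact: is_derive1_powR.
have := is_derive1_comp d1
  (is_deriveD (is_derive_cst (1 : R) x 1) (is_derive_id x 1)).
by rewrite /GRing.scale/= add0r mulr1.
Qed.

Lemma integral_1D_powR (b : R) : 0 < b ->
  (\int[mu]_(w in `[0%R, +oo[) ((1 + w) `^ (- b - 1))%:E = (b^-1)%:E)%E.
Proof.
move=> b0.
have dF (x : R) : 0 <= x ->
    is_derive x 1 (fun w => - b^-1 * (1 + w) `^ (- b)) ((1 + x) `^ (- b - 1)).
  move=> x0; have := is_deriveZ (- b^-1) (is_derive_1D_powR (- b) x0).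
  by rewrite /GRing.scale /= !mulrA mulrNN mulVf ?gt_eqF// mul1r.
have cf : {within `[0, +oo[, continuous (fun w : R => (1 + w) `^ (- b - 1))}.
  apply: derivable_within_continuous => x; rewrite in_itv/= andbT => x0.
  by have [] := is_derive_1D_powR (- b - 1) x0.
rewrite (@ge0_continuous_FTC2y _ _ (fun w => - b^-1 * (1 + w) `^ (- b)) _ 0) //.
- by rewrite addr0 powR1 mulr1 sub0e -EFinN opprK.
- by move=> x _; exact: powR_ge0.
- rewrite -(mulr0 (- b^-1)); apply: cvgM; first exact: cvg_cst.
  exact: cvg_powRN_1D.
- by move=> x x0; have [] := dF x (ltW x0).
- have dc : {for 0, continuous (fun w : R => - b^-1 * (1 + w) `^ (- b))}.
    apply: differentiable_continuous; apply/derivable1_diffP.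
    by have [] := dF 0 (lexx _).
  exact: cvg_at_right_filter dc.
- move=> x; rewrite in_itv/= andbT => x0; rewrite derive1E.
  by have [_ ->] := dF x (ltW x0).
Qed.

(** By evenness the half-line suffices. There (1 + w)^2 <= 2 (1 + w^2), so the integrand is at most
    2^a (1 + w)^(-2a), integrable because 2a > 1. *)
Lemma integral_sqrD_powR_lty (a : R) : 2^-1 < a ->
  (\int[mu]_w ((1 ^+ 2 + w ^+ 2) `^ (- a))%:E < +oo)%E.
Proof.
move=> a2.
have w1 (w : R) : 0 < 1 ^+ 2 + w ^+ 2 by exact: sqrD_gt0.
rewrite ge0_symfun_integralT; last 3 first.
- by move=> x; exact: powR_ge0.
- move=> x.
  apply: (@continuous_comp _ _ _ (fun w : R => 1 ^+ 2 + w ^+ 2) (@powR R ^~ (- a))).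
    apply: cvgD; [exact: cvg_cst|exact: sqr_continuous].
  apply: differentiable_continuous; apply/derivable1_diffP.
  by have [] := is_derive1_powR (- a) (w1 x).
- by move=> x /=; rewrite sqrrN.
rewrite -set_itvcy lte_mul_pinfty//.
pose b := 2 * a - 1; have b0 : 0 < b by rewrite /b; lra.
apply: (@le_lt_trans _ _ ((2 `^ a)%:E * (b^-1)%:E)%E); last by rewrite -EFinM ltry.
have m1 : measurable_fun (`[0%R, +oo[%classic : set R)
    (fun w : R => ((1 + w) `^ (- b - 1))%:E).
  apply/measurable_EFinP/measurable_funTS.
  apply: (measurableT_comp (measurable_powR (- b - 1))).
  by apply: measurable_funD; [exact: measurable_cst|exact: measurable_id].
rewrite -integral_1D_powR// -ge0_integralZl//; last first.
  by move=> x _; rewrite lee_fin powR_ge0.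
apply: ge0_le_integral => //.
- by move=> x _; rewrite lee_fin powR_ge0.
- exact: measurable_sqrD_powR.
- exact: measurable_funeM.
move=> x /=; rewrite in_itv/= andbT => x0.
rewrite -EFinM lee_fin !powRN.
rewrite (_ : - b - 1 = - (2 * a)); last by rewrite /b; ring.
have x1 : 0 < 1 + x by rewrite ltr_pwDl.
rewrite powRN ler_pdivlMr ?powR_gt0// mulrC ler_pdivrMr ?powR_gt0//.
rewrite -powRM ?(ltW (w1 x))// powRrM powR_mulrn ?(ltW x1)//.
apply: ge0_ler_powR; rewrite ?nnegrE ?sqr_ge0 ?mulr_ge0 ?(ltW (w1 x))//; first lra.
by rewrite expr1n; have := sqr_ge0 (1 - x); lra.
Qed.

(* [egamma_integral_powR] deduces the finiteness of Gamma(y) from that of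
   Gamma(y + 1/2), which avoids integrating the singularity at 0. *)
Lemma egamma_lty (x : R) : 0 < x -> (egamma x < +oo)%E.
Proof.
have step (y : R) : 0 < y -> (egamma (y + 2^-1) < +oo)%E -> (egamma y < +oo)%E.
  move=> y0 gy; have := egamma_integral_powR (y + 2^-1) (@ltr01 R).
  rewrite powR1 mulr1 addrK => e.
  have : ((Num.sqrt (@pi R))%:E * egamma y < +oo)%E.
    rewrite -e lte_mul_pinfty ?egamma_ge0 ?ge0_fin_numE ?egamma_ge0//.
    by apply: integral_sqrD_powR_lty; rewrite ltrDr.
  rewrite !ltey; apply: contra => /eqP ->.
  by rewrite gt0_muley// lte_fin sqrtr_gt0 pi_gt0.
(* Two half-steps lead from x to x + 1 > 1. *)
move=> x0; apply: (step _ x0); apply: step; first lra.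
by apply: egamma_gt1_lty; lra.
Qed.

Lemma egamma_fin_num (x : R) : 0 < x -> egamma x \is a fin_num.
Proof. by move=> x0; rewrite ge0_fin_numE ?egamma_ge0// egamma_lty. Qed.

(* Tonelli's theorem for exp(-t) on the region w^2 <= t. *)
Lemma egamma_3half : (egamma (3 / 2 : R) = (Num.sqrt pi / 2)%:E)%E.
Proof.
pose h (z : measurableTypeR R * measurableTypeR R) : R :=
  if z.1 ^+ 2 <= z.2 then expR (- z.2) else 0.
have h0 z : (0 <= (h z)%:E)%E.
  by rewrite lee_fin /h; case: ifP => // _; exact: expR_ge0.
have mh : measurable_fun setT (fun z => (h z)%:E).
  apply/measurable_EFinP; apply: measurable_fun_ifT => //.
  - by apply: measurable_fun_ler => //; exact: measurable_funX.
  - by apply: measurableT_comp => //; apply: measurableT_comp.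
have := fubini_tonelli (m1 := mu) (m2 := mu) (fun z => (h z)%:E) mh h0.
(* Integrating over t >= w^2 first gives exp(-w^2), hence the Gaussian integral. *)
have -> : (\int[mu]_x \int[mu]_y (h (x, y))%:E = (Num.sqrt pi)%:E)%E.
  rewrite -integralT_gauss; apply: eq_integral => x _.
  rewrite /gauss_fun -integral_expRN [RHS]integral_mkcond.
  apply: eq_integral => y _ /=; rewrite patchE /h/= mem_setE in_itv/= andbT.
  by case: ifP.
(* For fixed t >= 0 the slice is |w| <= sqrt t, of length 2 sqrt t, and sqrt t = t^(3/2 - 1). *)
have -> : (\int[mu]_y \int[mu]_x (h (x, y))%:E = 2%:E * egamma (3 / 2 : R))%E.
  rewrite /egamma -ge0_integralZl//; last 2 first.
  - by apply: eq_measurable_fun (measurable_gamma_fun (3 / 2 - 1) 1) => t _; rewrite mulr1.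
  - by move=> x _; rewrite lee_fin mulr_ge0 ?powR_ge0 ?expR_ge0.
  have hE (y : R) : 0 <= y ->
      (\int[mu]_x (h (x, y))%:E = (2 * (Num.sqrt y * expR (- y)))%:E)%E.
    move=> y0.
    transitivity (\int[mu]_(x in `[(- Num.sqrt y)%R, Num.sqrt y])
        (cst (expR (- y))%:E x))%E.
      rewrite [RHS]integral_mkcond; apply: eq_integral => x _ /=.
      rewrite patchE /h/= mem_setE in_itv/= -ler_norml -sqrtr_sqr ler_sqrt//.
      by case: ifP.
    rewrite integral_cst//= lebesgue_measure_itv/= lte_fin.
    case: ifPn => [_|]; first by rewrite -EFinD -EFinM; congr EFin; ring.
    rewrite ltNge negbK => sy; have := sqrtr_ge0 y => sy0.
    by rewrite (_ : Num.sqrt y = 0) ?mul0r ?mulr0 ?mule0//; lra.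
  rewrite [RHS]integral_mkcond; apply: eq_integral => y _ /=; rewrite patchE.
  rewrite mem_setE in_itv/= andbT; case: ifPn => [y0|]; last first.
    (* Outside ]0, +oo[ the slices contribute nothing: at 0 the slice has length 0, and below 0 it
       is empty. *)
    rewrite -leNgt le_eqVlt => /predU1P[->|y0].
      by rewrite hE// sqrtr0 mul0r mulr0.
    apply: integral0_eq => x _; rewrite /h/= ifF//.
    by apply/negbTE; rewrite -ltNge (lt_le_trans y0)// sqr_ge0.
  rewrite hE ?(ltW y0)// EFinM (_ : 3 / 2 - 1 = 2^-1) ?powR12_sqrt ?(ltW y0)//.
  by field.
move/esym => e.
have -> : egamma (3 / 2 : R) = (2^-1%:E * (2%:E * egamma (3 / 2 : R)))%E.
  by rewrite muleA -EFinM mulVf// mul1e.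
by rewrite e -EFinM mulrC.
Qed.

(** * Special values of Gamma and the beta factor *)

Lemma EFin_gamma (x : R) : 0 < x -> (gamma x)%:E = egamma x.
Proof. by move=> x0; rewrite /gamma x0 fineK// egamma_fin_num. Qed.

Lemma gamma_gt0 (x : R) : 0 < x -> 0 < gamma x.
Proof. by move=> x0; rewrite -lte_fin EFin_gamma// egamma_gt0. Qed.

(** The floor of -1/2 is -1, so the continuation shifts by k = 2: Gamma(-1/2) = Gamma(3/2) / ((-1/2)
    (1/2)), which is why Gamma(3/2) is the value computed above. *)
Lemma gammaN_half : gamma (- 2^-1 : R) = - 2 * Num.sqrt pi.
Proof.
rewrite /gamma ifF; last by apply/negbTE; rewrite -leNgt; lra.
have -> : Num.floor (- 2^-1 : R) = - 1.
  apply: floor_def; apply/andP; split; rewrite ?addNr; lra.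
rewrite [absz _]/=.
rewrite big_nat_recr//= big_nat1.
have -> : - 2^-1 + 2%:R = 3 / 2 :> R by field.
rewrite /euler_gamma /Rintegral -/(egamma _) egamma_3half/=.
by field.
Qed.

Lemma gamma0 : gamma (0 : R) = 0.
Proof.
by rewrite /gamma ltxx floor0 /= big_nat1 addr0 invr0 mulr0.
Qed.

(* At p = 1 both sides are +oo. *)
Lemma integral_sqrD_powRE (l p : R) : 0 < l -> 1 <= p ->
  (((2 * pi)^-1)%:E * \int[mu]_w ((l ^+ 2 + w ^+ 2) `^ (- (p / 2)))%:E
   = (- beta (p / 2) (- 2^-1))%:E^-1 * (l `^ (1 - p))%:E)%E.
Proof.
move=> l0 p1.
have p20 : 0 < p / 2 by lra.
have pi0 := pi_gt0 R.
have sp0 : 0 < Num.sqrt pi :> R by rewrite sqrtr_gt0.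
have := egamma_integral_powR (p / 2) l0.
rewrite -(EFin_gamma p20) (_ : 1 - 2 * (p / 2) = 1 - p); last by field.
have g0 := gamma_gt0 p20.
set I := (\int[mu]_w _)%E => e.
have -> : I = ((gamma (p / 2))^-1%:E * ((gamma (p / 2))%:E * I))%E.
  by rewrite muleA -EFinM mulVf ?mul1e// gt_eqF.
rewrite {}e /beta gammaN_half.
move: p1; rewrite le_eqVlt => /predU1P[<-|p1].
  (* At the pole the real value [gamma 0] is 0, so beta is 0 and its extended inverse +oo; on the
     left +oo comes from [egamma0]. *)
  rewrite (_ : 1 / 2 - 2^-1 = 0); last by field.
  rewrite egamma0 gamma0 invr0 mulr0 oppr0 inve0 subrr powRr0 mulr1 mule1.
  by rewrite !gt0_muley// lte_fin invr_gt0 ?gamma_gt0 ?mulr_gt0 ?divr_gt0.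
have q0 : 0 < p / 2 - 2^-1 by lra.
rewrite -EFin_gamma//; have := gamma_gt0 q0 => gq0.
have bE : - (gamma (p / 2) * (- 2 * Num.sqrt pi) / gamma (p / 2 - 2^-1)) =
    2 * gamma (p / 2) * Num.sqrt pi / gamma (p / 2 - 2^-1) by ring.
have b0 : 0 < 2 * gamma (p / 2) * Num.sqrt pi / gamma (p / 2 - 2^-1).
  by rewrite divr_gt0// !mulr_gt0.
rewrite bE inver (gt_eqF b0) -!EFinM.
congr EFin.
have -> : (2 * pi)^-1 = (2 * Num.sqrt pi * Num.sqrt pi)^-1 :> R.
  by rewrite -mulrA -expr2 sqr_sqrtr// ltW.
by field; rewrite !gt_eqF.
Qed.

(** First m is lowered to l; then the factor (l^2 + w^2)^(q - p), with q - p <= 0, is largest at w =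
    0. For fixed q the remaining integral does not depend on p. *)
Lemma integral_sqrD_powR_anti (l m p q : R) : 0 < l -> l <= m -> 0 <= q -> q <= p ->
  (\int[mu]_w ((m ^+ 2 + w ^+ 2) `^ (- p))%:E <=
   ((l ^+ 2) `^ (q - p))%:E * \int[mu]_w ((l ^+ 2 + w ^+ 2) `^ (- q))%:E)%E.
Proof.
move=> l0 lm q0 qp; have m0 : 0 < m by exact: lt_le_trans lm.
have p0 := le_trans q0 qp.
rewrite -ge0_integralZl//; last 3 first.
- exact: measurable_sqrD_powR.
- by move=> x _; rewrite lee_fin powR_ge0.
- by rewrite lee_fin powR_ge0.
apply: ge0_le_integral => //.
- by move=> x _; rewrite lee_fin powR_ge0.
- exact: measurable_sqrD_powR.
- by apply: measurable_funeM; exact: measurable_sqrD_powR.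
move=> w _; rewrite -EFinM lee_fin.
have lw := sqrD_gt0 w l0.
apply: (@le_trans _ _ ((l ^+ 2 + w ^+ 2) `^ (- p))).
  rewrite !powRN lef_pV2 ?posrE ?powR_gt0 ?sqrD_gt0//.
  apply: ge0_ler_powR; rewrite ?nnegrE ?(ltW lw) ?(ltW (sqrD_gt0 w m0)) ?p0//.
  by rewrite lerD2r ler_sqr ?nnegrE ?(ltW l0) ?(ltW m0).
rewrite [in leLHS](_ : - p = (q - p) + (- q)); last by ring.
rewrite powRD ?(gt_eqF lw) ?implybT// ler_wpM2r ?powR_ge0//.
rewrite (_ : q - p = - (p - q)); last by rewrite opprB.
rewrite !powRN lef_pV2 ?posrE ?powR_gt0 ?exprn_gt0//.
apply: ge0_ler_powR; rewrite ?nnegrE ?sqr_ge0 ?(ltW lw) ?subr_ge0//.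
by rewrite lerDl sqr_ge0.
Qed.

(** In the Tonelli identity at a = 1, Gamma(1) > 0 and Gamma(1/2) is finite, so the integral cannot
    be +oo. *)
Lemma integral_sqrD_powR1_lty (l : R) : 0 < l ->
  (\int[mu]_w ((l ^+ 2 + w ^+ 2) `^ (- 1))%:E < +oo)%E.
Proof.
move=> l0; have := egamma_integral_powR 1 l0.
rewrite ltey => e; apply/eqP => oo; move: e.
rewrite oo gt0_muley ?egamma_gt0// => /esym/eqP; apply/negP.
rewrite -ltey lte_mul_pinfty ?egamma_lty//; last lra.
by rewrite lee_fin mulr_ge0 ?sqrtr_ge0 ?powR_ge0.
Qed.

(** On [0, e], an interval of length e, l^2 + w^2 <= (l + e)^2. *)
Lemma integral_sqrD_powR_ge (l e p : R) : 0 < l -> 0 < e -> 0 <= p ->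
  ((e * (l + e) `^ (- p))%:E <= \int[mu]_w ((l ^+ 2 + w ^+ 2) `^ (- (p / 2)))%:E)%E.
Proof.
move=> l0 e0 p0.
apply: (@le_trans _ _ (\int[mu]_(w in `[0%R, e]) (cst ((l + e) `^ (- p))%:E w))%E).
  rewrite integral_cst//= lebesgue_measure_itv/= lte_fin e0 -EFinD subr0 -EFinM.
  by rewrite mulrC.
apply: (@le_trans _ _ (\int[mu]_(w in `[0%R, e]) ((l ^+ 2 + w ^+ 2) `^ (- (p / 2)))%:E)%E).
  apply: ge0_le_integral => //.
  - by move=> x _; rewrite lee_fin powR_ge0.
  - exact: measurable_sqrD_powR.
  move=> w /=; rewrite in_itv/= => /andP[w0 we].
  have lw := sqrD_gt0 w l0.
  have le0 : 0 < l + e by rewrite addr_gt0.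
  rewrite lee_fin (_ : - p = 2 * - (p / 2)); last by field.
  rewrite powRrM powR_mulrn ?(ltW le0)// !powRN lef_pV2 ?posrE ?powR_gt0 ?exprn_gt0//.
  apply: ge0_ler_powR; rewrite ?nnegrE ?sqr_ge0 ?(ltW lw) ?divr_ge0//.
  nra.
apply: ge0_subset_integral => //.
- exact: measurable_sqrD_powR.
- by move=> x _; rewrite lee_fin powR_ge0.
Qed.

End GammaIntegral.

(** * Roots of order p as p tends to infinity *)

Section Roots.
Variable R : realType.

Lemma cvg_root1 (x : R) : 0 < x -> x `^ p^-1 @[p --> +oo] --> (1 : R).
Proof.
move=> x0; under eq_fun do rewrite /powR gt_eqF//.
have V0 : p^-1 @[p --> +oo] --> (0 : R).
  by apply/gtr0_cvgV0; [exact: nbhs_pinfty_gt|exact: cvg_id].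
have h : p^-1 * ln x @[p --> +oo] --> 0 * ln x by apply: cvgM; [exact: V0|exact: cvg_cst].
by have := cvg_comp _ _ h (@continuous_expR R (0 * ln x)); rewrite mul0r expR0.
Qed.

(** For fixed e the lower bound tends only to 1 / (l + e). Hence e is first chosen so that this
    limit is close to 1 / l, and only then is p made large. *)
Lemma cvg_root_squeeze (g : R -> \bar R) (l K c : R) : 0 < l -> 0 < K -> 0 < c ->
  (forall p, 2 <= p -> (g p <= (K `^ p^-1 * l^-1)%:E)%E) ->
  (forall p e, 2 <= p -> 0 < e -> (((c * e) `^ p^-1 * (l + e)^-1)%:E <= g p)%E) ->
  g p @[p --> +oo] --> (l^-1)%:E.
Proof.
move=> l0 K0 c0 ub lb.
have gfin p : 2 <= p -> g p \is a fin_num.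
  move=> p2; apply/fin_real/andP; split; last exact: le_lt_trans (ub _ p2) (ltry _).
  by apply: lt_le_trans (lb _ _ p2 ltr01); exact: ltNyr.
apply/fine_cvgP; split.
  near=> p; apply: gfin; near: p; exact: nbhs_pinfty_ge.
apply/cvgrPdist_lt => e e0.
have [eps eps0 leps] : exists2 eps, 0 < eps & l^-1 - e < (l + eps)^-1.
  have : (l + x)^-1 @[x --> 0^'+] --> l^-1.
    have h : l + x @[x --> 0^'+] --> l + 0.
      by apply: cvgD; [exact: cvg_cst|apply: cvg_at_right_filter; exact: cvg_id].
    by have := cvgV _ h; rewrite addr0; apply; rewrite gt_eqF.
  move=> /cvgr_gt/(_ (l^-1 - e)); rewrite ltrBlDr ltrDl => /(_ e0) h.
  near (0 : R)^'+ => x; exists x; first by near: x; exact: nbhs_right_gt.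
  by near: x.
have cu : K `^ p^-1 * l^-1 @[p --> +oo] --> l^-1.
  suff : K `^ p^-1 * l^-1 @[p --> +oo] --> 1 * l^-1 by rewrite mul1r.
  by apply: cvgM; [exact: cvg_root1|exact: cvg_cst].
have cl : (c * eps) `^ p^-1 * (l + eps)^-1 @[p --> +oo] --> (l + eps)^-1.
  have ce0 : 0 < c * eps by rewrite mulr_gt0.
  suff : (c * eps) `^ p^-1 * (l + eps)^-1 @[p --> +oo] --> 1 * (l + eps)^-1.
    by rewrite mul1r.
  by apply: cvgM; [exact: cvg_root1|exact: cvg_cst].
near=> p.
have p2 : 2 <= p by near: p; exact: nbhs_pinfty_ge.
rewrite distrC ltr_norml -!lte_fin EFinB fineK ?gfin//.
rewrite /= -(fineK (gfin _ p2)) -EFinB !lte_fin.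
have := ub p p2; have := lb p eps p2 eps0; rewrite -(fineK (gfin _ p2)) !lee_fin => h1 h2.
have h3 : K `^ p^-1 * l^-1 < l^-1 + e.
  by near: p; move/cvgr_lt : cu; apply; rewrite ltrDl.
have h4 : l^-1 - e < (c * eps) `^ p^-1 * (l + eps)^-1.
  by near: p; move/cvgr_gt : cl; apply.
apply/andP; split; lra.
Unshelve. all: by end_near. Qed.

Lemma powR_root (x y p : R) : 0 <= x -> 0 < y -> 0 < p ->
  (x * y `^ (- p)) `^ p^-1 = x `^ p^-1 * y^-1.
Proof.
move=> x0 y0 p0; rewrite powRM ?powR_ge0// -powRrM mulNr mulfV ?gt_eqF//.
by rewrite powR_inv1// ltW.
Qed.

Lemma ler_poweR_root (x y : \bar R) (p : R) : (0 <= x)%E -> (x <= y)%E -> 0 < p ->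
  (x `^ p^-1 <= y `^ p^-1)%E.
Proof.
move=> x0 xy p0; apply: gt0_ler_poweR => //; first by rewrite invr_ge0 ltW.
  by rewrite in_itv/= x0 leey.
by rewrite in_itv/= (le_trans x0 xy) leey.
Qed.

End Roots.

(** * Simultaneously diagonalised matrices *)

Section ConjDiag.
Variables (K : fieldType) (n : nat).
Implicit Types (P A : 'M[K]_n) (f g : 'I_n -> K).

(** The columns of [invmx P] are eigenvectors with eigenvalues [f]. With [P] fixed, sums, products
    and inverses of such matrices are computed entrywise on [f]. *)
Definition conjdiag P f : 'M[K]_n := invmx P *m diag_mx (\row_i f i) *m P.

Lemma eq_conjdiag P f g : f =1 g -> conjdiag P f = conjdiag P g.
Proof.
move=> fg; have fgE : \row_i f i = \row_i g i by apply/rowP => i; rewrite !mxE.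
by rewrite /conjdiag fgE.
Qed.

Lemma conjdiagE P f i j : conjdiag P f i j = \sum_k invmx P i k * f k * P k j.
Proof.
rewrite /conjdiag mxE; apply: eq_bigr => k _; congr (_ * _).
by rewrite mul_mx_diag !mxE.
Qed.

Lemma conjdiagM P f g : P \in unitmx ->
  conjdiag P f *m conjdiag P g = conjdiag P (fun i => f i * g i).
Proof.
move=> uP; rewrite /conjdiag -!mulmxA (mulmxA P) mulmxV// mul1mx.
rewrite (mulmxA (diag_mx _)) mulmx_diag !mulmxA; congr (_ *m diag_mx _ *m _).
by apply/rowP => i; rewrite !mxE.
Qed.

Lemma conjdiagD P f g : conjdiag P f + conjdiag P g = conjdiag P (fun i => f i + g i).
Proof.
rewrite /conjdiag -mulmxDl -mulmxDr -raddfD/=; congr (_ *m diag_mx _ *m _).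
by apply/rowP => i; rewrite !mxE.
Qed.

Lemma conjdiag_scalar P (c : K) : P \in unitmx -> conjdiag P (fun=> c) = c%:M.
Proof.
move=> uP; rewrite /conjdiag (_ : diag_mx _ = c%:M).
  by rewrite mul_mx_scalar -scalemxAl mulVmx// scale_scalar_mx mulr1.
by rewrite -diag_const_mx; congr diag_mx; apply/rowP => i; rewrite !mxE.
Qed.

Lemma conjdiag_unit P f : P \in unitmx ->
  (conjdiag P f \in unitmx) = [forall i, f i != 0].
Proof.
move=> uP; rewrite /conjdiag !unitmx_mul unitmx_inv uP andbT /=.
rewrite unitmxE det_diag unitfE; apply/idP/forallP => [|f0].
  by move/prodf_neq0 => f0 i; have := f0 i isT; rewrite mxE.
by apply/prodf_neq0 => i _; rewrite mxE.
Qed.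

Lemma conjdiagV P f : P \in unitmx -> (forall i, f i != 0) ->
  invmx (conjdiag P f) = conjdiag P (fun i => (f i)^-1).
Proof.
move=> uP f0; have uf : conjdiag P f \in unitmx.
  by rewrite conjdiag_unit//; apply/forallP.
rewrite -[RHS](mulKmx uf) conjdiagM// -[LHS]mulmx1 -(conjdiag_scalar _ uP).
by congr (_ *m _); apply: eq_conjdiag => i; rewrite mulfV.
Qed.

(** Over the polynomial ring, X - P^-1 D P = P^-1 (X - D) P, and the determinants of P^-1 and P
    cancel. *)
Lemma char_poly_conjdiag P f : P \in unitmx ->
  char_poly (conjdiag P f) = \prod_i ('X - (f i)%:P).
Proof.
move=> uP; transitivity (char_poly (diag_mx (\row_i f i))); last first.
  rewrite char_poly_trig ?diag_mx_is_trig//.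
  by apply: eq_bigr => i _; rewrite !mxE eqxx mulr1n.
rewrite /char_poly /conjdiag.
have -> : char_poly_mx (invmx P *m diag_mx (\row_i f i) *m P) =
   map_mx polyC (invmx P) *m char_poly_mx (diag_mx (\row_i f i)) *m map_mx polyC P.
  rewrite /char_poly_mx mulmxBr mulmxBl -!map_mxM; congr (_ - _).
  by rewrite mul_mx_scalar -scalemxAl -map_mxM mulVmx// map_mx1 scalemx1.
by rewrite !det_mulmx mulrAC -det_mulmx -map_mxM mulVmx// map_mx1 det1 mul1r.
Qed.

Lemma conjdiag_eigenvector P f k i : P \in unitmx ->
  \sum_j conjdiag P f k j * invmx P j i = f i * invmx P k i.
Proof.
move=> uP; have : (conjdiag P f *m invmx P) k i = (invmx P *m diag_mx (\row_i f i)) k i.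
  by rewrite /conjdiag -!mulmxA mulmxV// mulmx1.
by rewrite mul_mx_diag !mxE mulrC.
Qed.

Lemma invmx_col_neq0 P i : P \in unitmx -> exists k, invmx P k i != 0.
Proof.
move=> uP; apply/existsP; apply: contraT; rewrite negb_exists => /forallP v0.
have : (P *m invmx P) i i = 0.
  by rewrite mxE big1// => k _; have := v0 k; rewrite negbK => /eqP ->; rewrite mulr0.
by rewrite mulmxV// mxE eqxx => /eqP; rewrite oner_eq0.
Qed.

(* The matrix with eigenvalues (f i != 0) is the projection along the kernel of
   A; since the kernel consists of the constant vectors, its complement
   1 - conjdiag P _ is a constant matrix, and its rows sum to 1. *)
Lemma centering_conjdiag P A f : (n%:R : K) != 0 -> P \in unitmx -> A^T = A ->
  A = conjdiag P f -> A *m (const_mx 1 : 'M[K]_n) = 0 ->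
  (forall v : 'I_n -> K, (forall i, \sum_j A i j * v j = 0) ->
     forall i j, v i = v j) ->
  1%:M - const_mx n%:R^-1 = conjdiag P (fun i => (f i != 0)%:R).
Proof.
move=> n0 uP Asym AE AJ ker; set Q := conjdiag P _.
have AX : A *m (1%:M - Q) = 0.
  rewrite mulmxBr mulmx1 AE /Q conjdiagM//; apply/eqP; rewrite subr_eq0; apply/eqP.
  apply: eq_conjdiag => i; case: eqP => [->|_]; first by rewrite mul0r.
  by rewrite mulr1.
have XA : (1%:M - Q) *m A = 0.
  rewrite mulmxBl mul1mx AE /Q conjdiagM//; apply/eqP; rewrite subr_eq0; apply/eqP.
  apply: eq_conjdiag => i; case: eqP => [->|_]; first by rewrite mulr0.
  by rewrite mul1r.
have kerC (X : 'M[K]_n) : A *m X = 0 -> forall i i' j, X i j = X i' j.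
  move=> AX0 i i' j; apply: (ker (fun i => X i j)) => k.
  by transitivity ((A *m X) k j); [rewrite mxE|rewrite AX0 mxE].
set X := 1%:M - Q in AX XA.
(* A X = 0 makes the columns of X constant; X A = 0 and the symmetry of A do the same for its
   rows. *)
have Xc i j i' j' : X i j = X i' j'.
  rewrite (kerC _ AX i i'); have := kerC X^T _ j j' i'; rewrite !mxE; apply.
  by rewrite -Asym -trmx_mul XA trmx0.
pose J : 'M[K]_n := const_mx 1.
(* Q is A times its pseudo-inverse, so J A = 0 gives J Q = 0 and J X = J, which fixes the common
   entry of X. *)
have AQ : A *m conjdiag P (fun i => (f i)^-1) = Q.
  rewrite AE conjdiagM//; apply: eq_conjdiag => i.
  case: eqP => [->|/eqP fi]; first by rewrite mul0r.
  by rewrite mulfV.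
have JA : J *m A = 0.
  by rewrite -[J]trmxK trmx_const -Asym -trmx_mul AJ trmx0.
have JX : J *m X = J by rewrite mulmxBr mulmx1 -AQ mulmxA JA mul0mx subr0.
have Xn i : X i i * n%:R = 1.
  transitivity ((J *m X) i i); last by rewrite JX mxE.
  rewrite [RHS]mxE (eq_bigr (fun=> X i i)) => [|k _]; last first.
    by rewrite [J _ _]mxE mul1r (Xc k i i i).
  by rewrite sumr_const card_ord mulr_natr.
have -> : Q = 1%:M - X by rewrite /X opprB addrC subrK.
congr (_ - _); apply/matrixP => i j; rewrite mxE (Xc i j i i).
by apply: (mulIf n0); rewrite Xn mulVf.
Qed.

End ConjDiag.

(** * Unitary diagonalisation of Hermitian matrices *)

Section HermitianConjDiag.
Variables (K : numClosedFieldType) (n : nat).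
Implicit Types (P A : 'M[K]_n) (f g : 'I_n -> K).

Lemma conjdiag_adjoint P f : P \is unitarymx ->
  map_mx Num.conj (conjdiag P f)^T = conjdiag P (fun i => (f i)^*).
Proof.
move=> uP; rewrite /conjdiag invmx_unitary// !trmx_mul !map_mxM/=.
rewrite !map_trmx !trmxK tr_diag_mx map_diag_mx mulmxA.
congr (_ *m _ *m _); last by apply/matrixP => i j; rewrite !mxE conjCK.
by congr diag_mx; apply/rowP => i; rewrite !mxE.
Qed.

Lemma hermitian_conjdiag A : A \is hermsymmx ->
  A = conjdiag (spectralmx A) (spectral_diag A 0).
Proof.
move=> hA; have /hermitian_normalmx/orthomx_spectralP e := hA.
rewrite [LHS]e /conjdiag; congr (_ *m diag_mx _ *m _).
by apply/rowP => i; rewrite mxE.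
Qed.

End HermitianConjDiag.

Section Eigenvalues.
Local Open Scope complex_scope.
Variables (R : realType) (n : nat).

(** [eigenvalues] is an unspecified list of roots, determined up to order by the factorisation of
    the characteristic polynomial. *)
Lemma eigenvalues_conjdiag (P : 'M[R[i]]_n) (f : 'I_n -> R[i]) : P \in unitmx ->
  perm_eq (eigenvalues (conjdiag P f)) [seq f i | i <- index_enum 'I_n].
Proof.
move=> uP; apply: prod_XsubC_eq.
rewrite /eigenvalues; case: closed_field_poly_normal => r /= e.
have := e; rewrite (monicP (char_poly_monic _)) scale1r => <-.
by rewrite big_map (char_poly_conjdiag _ uP).
Qed.

End Eigenvalues.

(** * The spectrum of the Laplacian *)

Section Laplacian.
Variables (R : realType) (n : nat) (G : wgraph R n).
Local Notation C := R[i].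
Local Notation toC := (real_complex R).
Local Open Scope complex_scope.
Local Notation a := (adjacency G).
Local Notation L := (laplacian G).

Lemma adjacency_sym i j : a i j = a j i.
Proof. by rewrite !mxE finset.setUC. Qed.

Lemma adjacency_ge0 i j : 0 <= a i j.
Proof. by rewrite mxE; case: ifP => // /weight_gt0/ltW. Qed.

Lemma edge_neq i j : [set i; j]%SET \in edges G -> i != j.
Proof. by move=> /edges_card2; rewrite cards2; case: (i != j). Qed.

(** The edges at i are indexed by their other endpoint. *)
Lemma degreeE i : degree G i = \sum_j a i j.
Proof.
rewrite /degree.
have other e : e \in edges G -> i \in e -> exists j, e = [set i; j]%SET.
  move=> /edges_card2/eqP/cards2P[x [y [xy ->]]].
  rewrite !inE => /orP[/eqP<-|/eqP<-].
    by exists y.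
  by exists x; rewrite finset.setUC.
(* The other endpoint of an edge at i; the default i is never taken on such an edge. *)
pose h' (e : {set 'I_n}) := odflt i [pick j | e == [set i; j]%SET].
rewrite (reindex_onto (fun j => [set i; j]%SET) h'); last first.
  move=> e /andP[eG ie]; rewrite /h'; case: pickP => [j /eqP-> //|].
  by have [j ->] := other e eG ie; move=> /(_ j); rewrite eqxx.
rewrite [RHS](bigID (fun j => [set i; j]%SET \in edges G))/=.
rewrite [X in _ = _ + X]big1 ?addr0; last first.
  by move=> j /negbTE ij; rewrite mxE ij.
apply: eq_big => [j|j /andP[/andP[ij _] _]]; last by rewrite mxE ij.
have [ij|//] := boolP (_ \in edges G).
rewrite in_set2 eqxx/= /h'.
case: pickP => [k /eqP/setP/(_ j)|/(_ j)]; last by rewrite eqxx.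
(* From {i, j} = {i, k} follows j = i or j = k; an edge has two elements, which excludes j = i. *)
rewrite !inE eqxx orbT => /esym/orP[/eqP jE|/eqP->]; last by rewrite eqxx.
by move/edge_neq : ij; rewrite jE eqxx.
Qed.

Lemma laplacianE i (v : 'I_n -> C) :
  \sum_j toC (L i j) * v j = \sum_j toC (a i j) * (v i - v j).
Proof.
under [RHS]eq_bigr do rewrite mulrBr.
rewrite sumrB -mulr_suml -rmorph_sum -degreeE.
under eq_bigr do rewrite mxE [X in X + _]mxE mxE rmorphD mulrDl
  [X in _ + toC X * _]mxE rmorphN mulNr.
rewrite big_split/= sumrN; congr (_ - _).
rewrite (bigD1 i)//= big1 ?addr0 ?eqxx ?mulr1n// => j /negbTE ji.
by rewrite eq_sym ji mulr0n rmorph0 mul0r.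
Qed.

Lemma laplacian_sym : L^T = L.
Proof.
apply/matrixP => i j; rewrite mxE mxE [RHS]mxE; congr (_ + _).
  by rewrite !mxE eq_sym; case: eqVneq => // ->.
by rewrite mxE [RHS]mxE adjacency_sym.
Qed.

(** The sum is averaged with its copy in which i and j are exchanged; the two terms of each pair
    combine to |v_i - v_j|^2. *)
Lemma laplacian_form (v : 'I_n -> C) :
  \sum_i (v i)^* * (\sum_j toC (L i j) * v j) =
  2^-1 * \sum_i \sum_j toC (a i j) * `|v i - v j| ^+ 2.
Proof.
under eq_bigr do rewrite laplacianE mulr_sumr.
set S := LHS.
have S2 : S = \sum_i \sum_j (v j)^* * (toC (a i j) * (v j - v i)).
  by rewrite /S exchange_big/=; do 2 apply: eq_bigr => ? _; rewrite adjacency_sym.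
apply: (@mulfI _ 2) => //; rewrite mulrA mulfV ?mul1r// mulr_natl mulr2n.
rewrite {1}S2 /S -big_split/=; apply: eq_bigr => i _.
rewrite -big_split/=; apply: eq_bigr => j _.
rewrite normCK rmorphB/=; ring.
Qed.

(** The quadratic form vanishes at v, hence so does each of its non-negative terms. So v agrees
    across every edge, and along paths by connectedness. *)
Lemma laplacian_ker (v : 'I_n -> C) :
  (forall i, \sum_j toC (L i j) * v j = 0) -> forall i j, v i = v j.
Proof.
move=> Lv.
have S0 : \sum_i \sum_j toC (a i j) * `|v i - v j| ^+ 2 = 0.
  have := laplacian_form v; rewrite big1 => [|i _]; last by rewrite Lv mulr0.
  by move/esym/eqP; rewrite mulf_eq0 invr_eq0 pnatr_eq0 => /eqP.
have t0 i j : 0 <= toC (a i j) * `|v i - v j| ^+ 2.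
  by rewrite mulr_ge0 ?exprn_ge0// lecR adjacency_ge0.
have edge i j : [set i; j]%SET \in edges G -> v i = v j.
  move=> ij.
  have /(_ i isT) := psumr_eq0P (fun i _ => sumr_ge0 _ (fun j _ => t0 i j)) S0.
  move/psumr_eq0P => /(_ (fun j _ => t0 i j)) /(_ j isT)/eqP.
  rewrite mulf_eq0 expf_eq0/= normr_eq0 subr_eq0 => /orP[|/eqP//].
  by rewrite fmorph_eq0 mxE ij gt_eqF// weight_gt0.
move=> i j; have /connectP[s ps ->] := wgraph_connected G i j.
elim: s i ps => //= k s IH i /andP[ik /IH <-]; exact: edge.
Qed.

Lemma laplacian_const_mx : map_mx toC L *m (const_mx 1 : 'M[C]_n) = 0.
Proof.
apply/matrixP => i j; rewrite !mxE.
transitivity (\sum_j toC (L i j) * 1); first by apply: eq_bigr => k _; rewrite !mxE.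
by rewrite laplacianE big1// => k _; rewrite subrr mulr0.
Qed.

Lemma laplacian_hermitian : map_mx toC L \is hermsymmx.
Proof.
apply: realsym_hermsym.
  by apply/is_hermitianmxP; rewrite expr0 scale1r map_mx_id // map_trmx laplacian_sym.
by apply/mxOverP => i j; rewrite mxE; apply/CrealP; exact: conjc_real.
Qed.

(** The product of x with the squared norm of v is the value of the quadratic form at v, which is
    non-negative. *)
Lemma laplacian_eigenvalue_ge0 (v : 'I_n -> C) (x : R) : (exists k, v k != 0) ->
  (forall k, \sum_j toC (L k j) * v j = toC x * v k) -> 0 <= x.
Proof.
move=> [k0 vk0] Lv.
have N0 : 0 < \sum_k `|v k| ^+ 2.
  rewrite (bigD1 k0)//= ltr_pwDl ?exprn_gt0 ?normr_gt0//.
  by apply: sumr_ge0 => k _; rewrite exprn_ge0.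
have : 0 <= toC x * \sum_k `|v k| ^+ 2.
  rewrite mulr_sumr (eq_bigr (fun k => (v k)^* * \sum_j toC (L k j) * v j)); last first.
    by move=> k _; rewrite Lv normCK; ring.
  rewrite laplacian_form mulr_ge0 ?invr_ge0// sumr_ge0// => k _.
  rewrite sumr_ge0// => j _.
  by rewrite mulr_ge0 ?exprn_ge0// lecR adjacency_ge0.
by rewrite pmulr_lge0// lecR.
Qed.

Lemma laplacian_spectral : (0 < n)%N ->
  exists (P : 'M[C]_n) (d : 'I_n -> R),
  [/\ P \is unitarymx, map_mx toC L = conjdiag P (fun i => toC (d i)),
      forall i, 0 <= d i &
      map_mx toC (centering R n) = conjdiag P (fun i => (d i != 0)%:R)].
Proof.
move=> n0; have hL := laplacian_hermitian.
pose P := spectralmx (map_mx toC L).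
have uP : P \is unitarymx := spectral_unitarymx _.
have uP' := unitarymx_unit uP.
pose d i := complex.Re (spectral_diag (map_mx toC L) 0 i).
have dE i : spectral_diag (map_mx toC L) 0 i = toC (d i).
  have /mxOverP/(_ 0 i)/CrealP := hermitian_spectral_diag_real hL.
  rewrite /d; case: (spectral_diag _ _ _) => x y [] /eqP.
  by rewrite eq_sym -addr_eq0 -mulr2n mulrn_eq0/= => /eqP ->.
have LE : map_mx toC L = conjdiag P (fun i => toC (d i)).
  have e : map_mx toC L = conjdiag P (fun i => spectral_diag (map_mx toC L) 0 i).
    exact: hermitian_conjdiag hL.
  refine (etrans e _); apply: eq_conjdiag => i; exact: dE.
have d0 i : 0 <= d i.
  apply: (@laplacian_eigenvalue_ge0 (fun k => invmx P k i)); first exact: invmx_col_neq0.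
  move=> k; refine (etrans _ (conjdiag_eigenvector (fun i => toC (d i)) k i uP')).
  by apply: eq_bigr => j _; rewrite -LE [in RHS]mxE.
have n0' : n%:R != 0 :> C by rewrite pnatr_eq0 -lt0n.
have LT : (map_mx toC L)^T = map_mx toC L by rewrite map_trmx laplacian_sym.
have ker (v : 'I_n -> C) :
    (forall i, \sum_j map_mx toC L i j * v j = 0) -> forall i j, v i = v j.
  move=> Lv; apply: laplacian_ker => i; rewrite -[RHS](Lv i).
  by apply: eq_bigr => j _; rewrite [in RHS]mxE.
exists P, d; split; [exact: uP|exact: LE|exact: d0|].
have Q := centering_conjdiag n0' uP' LT LE laplacian_const_mx ker.
refine (etrans _ (etrans Q (eq_conjdiag P _))); last by move=> i; rewrite fmorph_eq0.
apply/matrixP => i j; rewrite !mxE rmorphB; congr (_ - _).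
  by rewrite rmorph_nat.
by rewrite fmorphV rmorph_nat.
Qed.

End Laplacian.

(** * The transfer function *)

Section LimFractions.
Variables (K : numFieldType) (n : nat) (c d : 'I_n -> K) (s : K).
Hypothesis sd : forall k, c k != 0 -> s + d k != 0.

(** A term with c k = 0 is identically 0, also where s + d k = 0: this is the removable
    singularity. *)
Lemma cvg_sum_fractions :
  (\sum_k c k / (z + d k) : K^o) @[z --> (s : K^o)^'] --> (\sum_k c k / (s + d k) : K^o).
Proof.
apply: cvg_big => [|k _]; first exact: add_continuous.
have [->|ck] := eqVneq (c k) 0.
  by under eq_fun do rewrite mul0r; rewrite mul0r; exact: cvg_cst.
apply: cvgM; first exact: cvg_cst.
apply: cvgV; first exact: sd.
apply: cvgD; last exact: cvg_cst.
exact: nbhs_dnbhs.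
Qed.

(** There are finitely many poles: one at s is excluded by puncturing the neighbourhood, the others
    by continuity. *)
Lemma near_shift_neq0 : \forall z \near (s : K^o)^', forall k, z + d k != 0.
Proof.
apply: filter_forall => k; have [e|sk] := eqVneq (s + d k) 0.
  near=> z; have : z != s by near: z; exact: nbhs_dnbhs_neq.
  by apply: contra => zd; rewrite -(inj_eq (addIr (d k))) e.
have : (z + d k : K^o) @[z --> (s : K^o)^'] --> (s + d k : K^o).
  by apply: cvgD; [exact: nbhs_dnbhs|exact: cvg_cst].
by move/cvgr_neq0; apply.
Unshelve. all: by end_near. Qed.

Lemma lim_sum_fractions (F : K -> K) :
  (forall z, (forall k, z + d k != 0) -> F z = \sum_k c k / (z + d k)) ->
  lim ((F z : K^o) @[z --> (s : K^o)^']) = \sum_k c k / (s + d k).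
Proof.
move=> FE; apply: cvg_lim; first exact: norm_hausdorff.
apply: cvg_trans cvg_sum_fractions; apply: near_eq_cvg.
by apply: filterS near_shift_neq0 => z /FE.
Qed.

End LimFractions.

Section Transfer.
Variables (R : realType) (n : nat) (N : consensus_network R n).
Local Notation C := R[i].
Local Notation toC := (real_complex R).
Local Notation LC := (map_mx toC (laplacian (network_graph N))).
Variables (P : 'M[C]_n) (d : 'I_n -> R).
Hypothesis uP : P \in unitmx.
Hypothesis LE : LC = conjdiag P (fun i => toC (d i)).
Hypothesis ME : map_mx toC (centering R n) = conjdiag P (fun i => (d i != 0)%:R).

Lemma shifted_laplacianE (s : C) : s%:M + LC = conjdiag P (fun i => s + toC (d i)).
Proof.
have H := conjdiagD P (fun=> s) (fun i => toC (d i)).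
refine (etrans _ H); congr (_ + _); last exact: LE.
by apply: esym; exact: (conjdiag_scalar s uP).
Qed.

Lemma transfer_formulaE (s : C) : (forall i, s + toC (d i) != 0) ->
  transfer_formula N s = conjdiag P (fun i => (d i != 0)%:R / (s + toC (d i))).
Proof.
move=> s0; have H := conjdiagM (fun i => (d i != 0)%:R) (fun i => (s + toC (d i))^-1) uP.
refine (etrans _ H); congr (_ *m _); first exact: ME.
by refine (etrans (congr1 _ (shifted_laplacianE s)) _); exact: (conjdiagV uP s0).
Qed.

(** Where s + L is invertible this is the direct formula. Otherwise each entry is a limit of a sum
    of simple fractions, whose singular terms carry the coefficient 0 from the centering matrix. *)
Lemma transfer_functionE (s : C) : (forall i, d i != 0 -> s + toC (d i) != 0) ->
  transfer_function N s = conjdiag P (fun i => (d i != 0)%:R / (s + toC (d i))).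
Proof.
move=> sd; rewrite /transfer_function; case: ifPn => [u|_].
  apply: transfer_formulaE => i; move: u; rewrite shifted_laplacianE.
  by rewrite (conjdiag_unit _ uP) => /forallP/(_ i).
apply/matrixP => i j; rewrite mxE conjdiagE.
pose c k : C := invmx P i k * (d k != 0)%:R * P k j.
pose D k := toC (d k).
have cE k z : invmx P i k * ((d k != 0)%:R / (z + D k)) * P k j = c k / (z + D k).
  by rewrite /c -!mulrA; congr (_ * (_ * _)); rewrite mulrC.
have sD k : c k != 0 -> s + D k != 0.
  move=> ck; apply: sd; apply: contraNneq ck => dk.
  by rewrite /c dk eqxx mulr0 mul0r.
have FE z : (forall k, z + D k != 0) ->
    transfer_formula N z i j = \sum_k c k / (z + D k).
  by move=> zD; rewrite transfer_formulaE// conjdiagE; apply: eq_bigr => k _; exact: cE.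
rewrite (eq_bigr (fun k => c k / (s + D k))) => [|k _]; last exact: cE.
by rewrite (lim_sum_fractions sD FE).
Qed.

End Transfer.

(** * Singular values and the zeta function from a diagonalisation *)

Section SchattenConjdiag.
Variables (R : realType) (n : nat).
Local Notation C := R[i].
Local Notation toC := (real_complex R).
Local Open Scope complex_scope.
Variables (P : 'M[C]_n).

(** As P is unitary, A^* A is diagonalised by the same P, with eigenvalues |f i|^2. *)
Lemma singular_values_conjdiag (f : 'I_n -> C) (sv : 'I_n -> R) :
  P \is unitarymx ->
  (forall i, 0 <= sv i) -> (forall i, (f i)^*%C * f i = toC (sv i ^+ 2)) ->
  perm_eq (singular_values (conjdiag P f)) [seq sv i | i <- index_enum 'I_n].
Proof.
move=> uP sv0 fsv; rewrite /singular_values conjdiag_adjoint//.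
rewrite conjdiagM ?unitarymx_unit//.
have -> : [seq sv i | i <- index_enum 'I_n] =
    [seq Num.sqrt (complex.Re z) | z <- [seq (f i)^*%C * f i | i <- index_enum 'I_n]].
  rewrite -map_comp; apply: eq_map => i /=.
  by rewrite fsv/= sqrtr_sqr ger0_norm.
by apply: perm_map; apply: eigenvalues_conjdiag; exact: unitarymx_unit.
Qed.

Lemma zeta_conjdiag (G : wgraph R n) (d : 'I_n -> R) (q : R) : P \in unitmx ->
  map_mx toC (laplacian G) = conjdiag P (fun i => toC (d i)) ->
  zeta G q = \sum_(i | d i != 0) d i `^ (- q).
Proof.
move=> uP LE; rewrite /zeta /laplacian_eigenvalues LE.
rewrite big_map (perm_big _ (eigenvalues_conjdiag _ uP))/= big_map.
by apply: eq_bigl.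
Qed.

End SchattenConjdiag.

(** * The gains of the modes of a network *)

Section Network.
Variables (R : realType) (n : nat) (N : consensus_network R n).
Local Notation C := R[i].
Local Notation toC := (real_complex R).

(* The modulus of the transfer function at frequency w on the eigenspace of l;
   the centering matrix kills the eigenvalue 0. *)
Local Open Scope complex_scope.

Definition mode_gain (l w : R) : R :=
  if l != 0 then (Num.sqrt (l ^+ 2 + w ^+ 2))^-1 else 0.

Lemma mode_gain_le (l m w : R) : 0 < l -> l <= m -> mode_gain m w <= l^-1.
Proof.
move=> l0 lm; have m0 := lt_le_trans l0 lm.
rewrite /mode_gain gt_eqF//= lef_pV2 ?posrE ?sqrtr_gt0 ?sqrD_gt0//.
rewrite (le_trans lm)// -[leLHS](gtr0_norm m0) -sqrtr_sqr.
rewrite ler_sqrt ?(ltW (sqrD_gt0 w m0))//.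
by rewrite lerDl sqr_ge0.
Qed.

Lemma network_modes : (0 < n)%N ->
  exists2 d : 'I_n -> R, forall i, 0 <= d i &
    (forall q, zeta (network_graph N) q = \sum_(i | d i != 0) d i `^ (- q)) /\
    forall w, perm_eq (singular_values (transfer_function N (0 +i* w)))
                [seq mode_gain (d i) w | i <- index_enum 'I_n].
Proof.
move=> n0; have [P [d [uP LE d0 ME]]] := laplacian_spectral (network_graph N) n0.
have uP' := unitarymx_unit uP.
exists d => //; split=> [q|w]; first exact: zeta_conjdiag uP' LE.
rewrite (transfer_functionE uP' LE ME) => [|i di]; last first.
  by apply: contra di => /eqP[/eqP]; rewrite add0r.
apply: singular_values_conjdiag => // i; rewrite /mode_gain.
  by case: ifP => // _; rewrite invr_ge0 sqrtr_ge0.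
case: ifP => [di|_]; last by rewrite !mul0r conjc0 mul0r expr0n rmorph0.
have -> : 0 +i* w + toC (d i) = d i +i* w.
  by apply/eqP; rewrite eq_complex/= add0r addr0 !eqxx.
rewrite !mul1r exprVn sqr_sqrtr ?addr_ge0 ?sqr_ge0// conjc_inv -invfM fmorphV.
congr (_^-1); apply/eqP; rewrite eq_complex/=.
by apply/andP; split; apply/eqP; ring.
Qed.

(** The modes of eigenvalue 0 contribute 0^p, which is 0 because p is not 0. *)
Lemma schatten_norm_modes (p w : R) (d : 'I_n -> R) (A : 'M[C]_n) : 1 <= p ->
  perm_eq (singular_values A) [seq mode_gain (d i) w | i <- index_enum 'I_n] ->
  schatten_norm p%:E A `^ p = \sum_(i | d i != 0) (d i ^+ 2 + w ^+ 2) `^ (- (p / 2)).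
Proof.
move=> p1 e; have p0 : p != 0 by lra.
rewrite /schatten_norm -powRrM mulVf// powRr1; last first.
  by apply: sumr_ge0 => s _; exact: powR_ge0.
rewrite (perm_big _ e)/= big_map (bigID (fun i => d i != 0))/= [X in _ + X]big1 ?addr0.
  apply: eq_bigr => i di; rewrite /mode_gain di -powR12_sqrt ?addr_ge0 ?sqr_ge0//.
  by rewrite -[(_ `^ _)^-1]powR_inv1 ?powR_ge0// -!powRrM; congr (_ `^ _); field.
by move=> i /negbTE di; rewrite /mode_gain di powR0.
Qed.

Lemma schatten_norm_oo_modes (w : R) (d : 'I_n -> R) (A : 'M[C]_n) :
  perm_eq (singular_values A) [seq mode_gain (d i) w | i <- index_enum 'I_n] ->
  schatten_norm +oo%E A = \big[Num.max/0]_i mode_gain (d i) w.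
Proof.
move=> e; rewrite /schatten_norm.
by rewrite (perm_big _ e)/= big_map.
Qed.

End Network.

(** * The H_p norms *)

Section Main.
Variables (R : realType) (n : nat) (N : consensus_network R n) (d : 'I_n -> R).
Local Notation mu := (@lebesgue_measure R).
Local Open Scope complex_scope.
Local Notation G := (network_graph N).
Hypothesis d0 : forall i, 0 <= d i.
Hypothesis dzeta : forall q, zeta G q = \sum_(i | d i != 0) d i `^ (- q).
Hypothesis dF : forall w, perm_eq (singular_values (transfer_function N (0 +i* w)))
                [seq mode_gain (d i) w | i <- index_enum 'I_n].

Let d_gt0 i : d i != 0 -> 0 < d i.
Proof. by move=> di; rewrite lt_neqAle eq_sym di d0. Qed.

(** At p = 1 the factor is +oo; it still distributes over the sum because the terms are
    non-negative. *)
Lemma neg_inv_beta_zetaE (p : R) : 1 <= p -> neg_inv_beta_zeta G p =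
  (\sum_(i | d i != 0%R)
    (((2 * pi)^-1)%:E * \int[mu]_w ((d i ^+ 2 + w ^+ 2) `^ (- (p / 2)))%:E))%E.
Proof.
move=> p1; rewrite /neg_inv_beta_zeta dzeta -sumEFin ge0_sume_distrr; last first.
  by move=> i _; rewrite lee_fin powR_ge0.
apply: eq_bigr => i di.
by rewrite integral_sqrD_powRE ?d_gt0// opprB.
Qed.

Lemma neg_inv_beta_zeta_ge0 (p : R) : 1 <= p -> (0 <= neg_inv_beta_zeta G p)%E.
Proof.
move=> p1; rewrite neg_inv_beta_zetaE//; apply: sume_ge0 => i _.
rewrite mule_ge0// ?integral_ge0//; last by move=> w _; rewrite lee_fin powR_ge0.
by rewrite lee_fin invr_ge0 mulr_ge0// pi_ge0.
Qed.

Lemma hp_norm_neg_inv_beta_zeta (p : R) : 1 <= p ->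
  (hp_norm p%:E (transfer_function N) `^ p = neg_inv_beta_zeta G p)%E.
Proof.
move=> p1; have p0 : p != 0 by lra.
rewrite /hp_norm -poweRrM mulVf//.
suff -> : (((2 * pi)^-1)%:E *
    \int[mu]_w (schatten_norm p%:E (transfer_function N (0 +i* w)) `^ p)%:E)%E
    = neg_inv_beta_zeta G p by rewrite poweRe1// neg_inv_beta_zeta_ge0.
rewrite neg_inv_beta_zetaE//.
under eq_integral do rewrite (schatten_norm_modes p1 (dF _)) -sumEFin -big_filter.
rewrite ge0_integral_sum//; last 2 first.
- by move=> i; exact: measurable_sqrD_powR.
- by move=> i w _; rewrite lee_fin powR_ge0.
rewrite big_filter ge0_sume_distrr// => i _.
by apply: integral_ge0 => w _; rewrite lee_fin powR_ge0.
Qed.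

Lemma hp_norm_ooE (x w0 : R) : 0 <= x -> (forall w i, mode_gain (d i) w <= x) ->
  x <= \big[Num.max/0]_i mode_gain (d i) w0 ->
  hp_norm +oo%E (transfer_function N) = x%:E.
Proof.
move=> x0 ub lb; rewrite /hp_norm; apply/eqP; rewrite eq_le; apply/andP; split.
  apply: ge_ereal_sup => _ [w _ <-]; rewrite lee_fin (schatten_norm_oo_modes (dF w)).
  by apply: bigmax_le.
apply: (@le_trans _ _ (schatten_norm +oo%E (transfer_function N (0 +i* w0)))%:E).
  by rewrite lee_fin (schatten_norm_oo_modes (dF w0)).
by apply: ereal_sup_ubound; exists w0.
Qed.

Lemma cvg_neg_inv_beta_zeta_root :
  (neg_inv_beta_zeta G p `^ p^-1)%E @[p --> +oo] --> hp_norm +oo%E (transfer_function N).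
Proof.
have [/existsP[j0 dj0]|] := boolP [exists j, d j != 0]; last first.
  rewrite negb_exists => /forallP all0.
  have all0' i : (d i != 0) = false by apply/negbTE; exact: all0.
  (* Without non-zero eigenvalues, as on a single node, the transfer function has norm 0 and the
     empty sum has root 0. *)
  rewrite (@hp_norm_ooE 0 0)//; last 2 first.
  - by move=> w i; rewrite /mode_gain all0'.
  - exact: bigmax_ge_id.
  apply: cvg_near_cst; near=> p.
  have p1 : 1 <= p by near: p; exact: nbhs_pinfty_ge.
  rewrite neg_inv_beta_zetaE// big_pred0 ?poweR0r// invr_eq0; lra.
case: (@arg_minP _ _ _ j0 (fun j => d j != 0) d dj0) => j dj jmin.
have l0 := d_gt0 dj; set l := d j in dj jmin l0.
have -> : hp_norm +oo%E (transfer_function N) = (l^-1)%:E.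
  apply: (@hp_norm_ooE _ 0); first by rewrite invr_ge0 ltW.
    move=> w i; have [di|di] := boolP (d i != 0).
      exact: mode_gain_le l0 (jmin _ di).
    by rewrite /mode_gain (negbTE di) invr_ge0 ltW.
  (* The supremum over frequencies is attained at w = 0 by the mode of the least non-zero
     eigenvalue. *)
  rewrite (_ : l^-1 = mode_gain (d j) 0); first exact: le_bigmax.
  by rewrite /mode_gain dj expr0n addr0 sqrtr_sqr gtr0_norm.
pose c := (2 * pi)^-1 : R.
have c0 : 0 < c by rewrite invr_gt0 mulr_gt0// pi_gt0.
pose I := (\int[mu]_w ((l ^+ 2 + w ^+ 2) `^ (- 1))%:E)%E.
have I0 : (0 <= I)%E by apply: integral_ge0 => w _; rewrite lee_fin powR_ge0.
have Ifin : I \is a fin_num by rewrite ge0_fin_numE// integral_sqrD_powR1_lty.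
(* At most n modes, each bounded by c l^2 I l^(-p); the added 1 makes K positive at once, and its
   p-th root still tends to 1. *)
pose K := n%:R * (c * (l ^+ 2 * fine I)) + 1.
have K1 : 0 <= c * (l ^+ 2 * fine I).
  by rewrite mulr_ge0 ?(ltW c0)// mulr_ge0 ?sqr_ge0// fine_ge0.
have K0 : 0 < K by rewrite ltr_wpDl// mulr_ge0.
apply: (cvg_root_squeeze l0 K0 c0).
  move=> p p2; have p0 : 0 < p by lra.
  have p1 : 1 <= p by lra.
  rewrite -powR_root ?(ltW K0)// -poweR_EFin; apply: ler_poweR_root => //.
    exact: neg_inv_beta_zeta_ge0.
  rewrite neg_inv_beta_zetaE//.
  pose x := c * (l ^+ 2 * fine I) * l `^ (- p).
  apply: (@le_trans _ _ (\sum_(i | d i != 0%R) x%:E)%E).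
    apply: lee_sum => i di.
    (* The comparison is made with exponent q = 1, admissible because p / 2 >= 1. *)
    apply: (@le_trans _ _ (c%:E * (((l ^+ 2) `^ (1 - p / 2))%:E * I))%E).
      apply: lee_wpmul2l; first by rewrite lee_fin ltW.
      by apply: integral_sqrD_powR_anti => //; [exact: jmin|lra].
    have -> : (l ^+ 2) `^ (1 - p / 2) = l ^+ 2 * l `^ (- p).
      rewrite -powR_mulrn ?(ltW l0)// -powRrM -powRD; last first.
        by rewrite (gt_eqF l0) implybT.
      by congr (_ `^ _); field.
    by rewrite -(fineK Ifin) -!EFinM lee_fin /x -!mulrA [fine I * _]mulrC.
  rewrite sumEFin lee_fin sumr_const.
  have x0 : 0 <= x by rewrite mulr_ge0// powR_ge0.
  apply: (@le_trans _ _ (x *+ n)).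
    by rewrite ler_wpMn2l// -[leqRHS]card_ord max_card.
  by rewrite /x /K mulrDl -mulr_natl mulrA lerDl mulr_ge0// powR_ge0.
move=> p e p2 e0; have p0 : 0 < p by lra.
have p1 : 1 <= p by lra.
have ce0 : 0 < c * e by rewrite mulr_gt0.
rewrite -powR_root ?(ltW ce0) ?addr_gt0// -poweR_EFin; apply: ler_poweR_root => //.
  by rewrite lee_fin mulr_ge0 ?powR_ge0// ltW.
(* For the lower bound only the mode of the least non-zero eigenvalue is kept. *)
rewrite neg_inv_beta_zetaE// (bigD1 j)//= -/l.
apply: (@le_trans _ _ (c%:E * \int[mu]_w ((l ^+ 2 + w ^+ 2) `^ (- (p / 2)))%:E)%E).
  rewrite -mulrA EFinM; apply: lee_wpmul2l; first by rewrite lee_fin ltW.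
  by apply: integral_sqrD_powR_ge => //; lra.
apply: leeDl; apply: sume_ge0 => i _.
apply: mule_ge0; first by rewrite lee_fin ltW.
by apply: integral_ge0 => w _; rewrite lee_fin powR_ge0.
Unshelve. all: by end_near. Qed.

End Main.

Theorem theorem3 (R : realType) (n : nat) (n_gt0 : (0 < n)%N)
    (N : consensus_network R n) :
  (forall p : R, 1 <= p ->
     (hp_norm p%:E (transfer_function N) `^ p)%E
     = neg_inv_beta_zeta (network_graph N) p)
  /\
  (neg_inv_beta_zeta (network_graph N) p `^ p^-1)%E @[p --> +oo]
     --> hp_norm +oo%E (transfer_function N).
Proof.
have [d d0 [dz dF]] := network_modes N n_gt0; split.
  by move=> p p1; exact: hp_norm_neg_inv_beta_zeta d0 dz dF p p1.
exact: cvg_neg_inv_beta_zeta_root d0 dz dF.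
Qed.
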